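(* Let $(X,\|\cdot\|)$ be a normed space, $C\subseteq X$ convex with $\operatorname{diam}(C)\le\kappa<\infty$, $T:C\to C$ an $\ell$-Lipschitz map with $0<\ell<1$, and $\alpha\in(0,1]$. Let $x_0\in C$ and let $(e_m)_{m\ge0}$ be errors in $X$ such that the iteration $$x_{m+1}=(1-\alpha)x_m+\alpha\,(Tx_m+e_m)\qquad(m\ge0)$$ satisfies $Tx_m+e_m\in C$ for all $m\ge 0$, so that $(x_m)$ is well defined and remains in $C$. Suppose that $\|e_m\|\le\kappa\,\varepsilon_m$ with $\varepsilon_m\ge0$ for all $m\ge 0$. Let $$R_m=(1-\ell)\,\ell_\alpha^{\,m}+\frac{\ell}{(1-\sigma)^2}\,F_1\!\left(\tfrac32;-m,1;3;\eta,-\xi\right)s_\alpha^{\,m},$$ where $\sigma=\sqrt\ell$, $\ell_\alpha=1-\alpha+\alpha\ell$, $s_\alpha=(1-\alpha+\alpha\sigma)^2$, $\eta=4\alpha(1-\alpha)\sigma/s_\alpha$ and $\xi=4\sigma/(1-\sigma)^2$. Then, for all integers $m\ge0$, $$\|x_m-Tx_m\|\le\kappa\left(R_m+2\alpha\sum_{i=0}^{m-1}R_{m-1-i}\,\varepsilon_i+2\varepsilon_m\right).$$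
   Context: $F_1$ is Appell's hypergeometric function, given here by Euler's integral (valid for $c>a>0$): $$F_1(a;b_1,b_2;c;u,v)=\frac{\Gamma(c)}{\Gamma(a)\Gamma(c-a)}\int_0^1\frac{x^{a-1}(1-x)^{c-a-1}}{(1-ux)^{b_1}(1-vx)^{b_2}}\,dx .$$ Equivalently, $R_m=c_{m,m+1}/\alpha$, where for $0\le m\le n$ $$c_{m,n}=\alpha\sum_{j=0}^{n-1}\sum_{k=0}^{m}\left[\binom{m}{k}\binom{n-1-j}{k}-\binom{n}{k}\binom{m-1-j}{k}\right](\alpha^2\ell)^k(1-\alpha)^{n+m-1-j-2k},$$ with $\binom{a}{k}=0$ unless $0\le k\le a$, $0^0=1$, and the inner sum restricted to $k\le\min\{m,n-1-j\}$ (the bracket vanishes for larger $k$). *)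

(* Defs.v *)
From HB Require Import structures.
From mathcomp Require Import all_boot all_order all_algebra.
From mathcomp Require Import all_classical all_reals all_analysis.

Set Implicit Arguments.
Unset Strict Implicit.
Unset Printing Implicit Defensive.

Import Order.TTheory GRing.Theory Num.Theory.
Import numFieldNormedType.Exports.

Local Open Scope classical_set_scope.
Local Open Scope ring_scope.

(* Valued in the extended reals; the empty set gets diameter -oo rather
   than 0. *)
Definition diam (R : realType) (X : normedModType R) (C : set X) : \bar R :=
  ereal_sup [set `|p.1 - p.2|%:E | p in C `*` C].

(* Meaningful for 0 < s, where the integral converges. *)
Definition Gamma (R : realType) (s : R) : R :=
  \int[@lebesgue_measure R]_(t in `]0, +oo[) (t `^ (s - 1) * expR (- t)).

(* Euler's integral for Appell's first hypergeometric function. It is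
   meaningful for 0 < a < c and u, v <= 1 with a convergent integral: powR is
   the usual real power only on nonnegative bases, and 1 - u * x, 1 - v * x
   are nonnegative on the interval of integration exactly when u, v <= 1. *)
Definition appellF1 (R : realType) (a b1 b2 c u v : R) : R :=
  Gamma c / (Gamma a * Gamma (c - a)) *
  \int[@lebesgue_measure R]_(x in `]0, 1[)
    (x `^ (a - 1) * (1 - x) `^ (c - a - 1) /
     ((1 - u * x) `^ b1 * (1 - v * x) `^ b2)).

Section Residual_bound.
Context {R : realType}.
Variables (alpha ell : R).

Definition sigma : R := Num.sqrt ell.
Definition ell_alpha : R := 1 - alpha + alpha * ell.
Definition s_alpha : R := (1 - alpha + alpha * sigma) ^+ 2.
Definition eta : R := 4 * alpha * (1 - alpha) * sigma / s_alpha.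
Definition xi : R := 4 * sigma / (1 - sigma) ^+ 2.

(* The arguments eta and - xi are at most 1 when 0 < ell < 1 and
   0 < alpha <= 1. *)
Definition residual_bound (m : nat) : R :=
  (1 - ell) * ell_alpha ^+ m +
  ell / (1 - sigma) ^+ 2 *
    appellF1 (3 / 2) (- m%:R) 1 3 eta (- xi) * s_alpha ^+ m.

End Residual_bound.

(* Main.v *)
Require Import Defs.
From HB Require Import structures.
From mathcomp Require Import all_boot all_order all_algebra.
From mathcomp Require Import all_classical all_reals all_analysis.
From mathcomp Require Import measurable_realfun ring lra.

(* With gap k = q - p >= 0, write x_(p+1) - T x_q and x_p - x_(q+1) as convex
   combinations of x_p - T x_q and of T x_p - T x_q, respectively
   x_p - x_q. This bounds |x_p - T x_(p+k)| and |x_p - x_(p+k)| by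
   kappa b(p,k) and kappa c(p,k), where b(0,k) = 1, c(p,0) = 0,
     b(p+1,k) = (1 - alpha) b(p,k+1) + alpha ell c(p,k+1),
     c(p,k+1) = (1 - alpha) c(p,k) + alpha b(p,k).
   The recursion is invariant under shifting both indices, so an error
   committed at step i is transmitted to the indices p > i with weight at most
   2 alpha b(p-1-i,k): one alpha for each of the two orbits through which it
   enters, and b because the total 2 alpha is then propagated from p = i+1
   exactly as the initial value 1 is from p = 0.

   The recursion is solved by the products u^p v^(p+k) with
   (u - (1 - alpha)) (v - (1 - alpha)) = alpha^2 ell. Putting
   w = 1 - alpha + alpha sigma e^(it), the choice u = conj w, v = w, integrated
   against sin t / |1 - sigma e^(it)|^2, gives solutions whose c vanishes at
   k = 0; adding the solution built on ell_alpha and 1 matches b(0,k) = 1 since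
   sin t / |1 - sigma e^(it)|^2 is the sum of the sigma^k sin((k+1)t). The
   substitution x = (1 - cos t) / 2 turns Euler's integral into the resulting
   formula for b(m,0), hence b(m,0) = R_m. *)

Set Implicit Arguments.
Unset Strict Implicit.
Unset Printing Implicit Defensive.

Import Order.TTheory GRing.Theory Num.Theory.
Import numFieldNormedType.Exports.

Local Open Scope classical_set_scope.
Local Open Scope ring_scope.

(** * Recursive estimates for the perturbed iteration *)

(** Split [y] as (1 - alpha) y + alpha y along the relaxation step. It is used with [y] an iterate,
    for distances, and with [y] the image of one, for residuals. *)
Lemma norm_sub_relax_le (R : realType) (X : normedModType R) (alpha : R)
    (y z t d : X) : 0 <= alpha -> alpha <= 1 ->
  `|y - ((1 - alpha) *: z + alpha *: (t + d))| <=
  (1 - alpha) * `|y - z| + alpha * `|y - t| + alpha * `|d|.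
Proof.
move=> alpha_ge0 alpha_le1.
have -> : y - ((1 - alpha) *: z + alpha *: (t + d)) =
    (1 - alpha) *: (y - z) + alpha *: (y - t) - alpha *: d.
  rewrite -[y in LHS](scale1r y) -{1}(subrK alpha 1) (scalerDl y).
  rewrite (scalerDr alpha t d) !opprD addrACA.
  by rewrite -scalerBr [X in _ + X]addrA -scalerBr addrA.
apply: le_trans (ler_normB _ _) _; apply: lerD.
  by apply: le_trans (ler_normD _ _) _; rewrite !normrZ !ger0_norm ?subr_ge0.
by rewrite normrZ ger0_norm.
Qed.

Section perturbed_iteration.
Context {R : realType} {X : normedModType R}.
Variables (C : set X) (kappa ell alpha : R) (T : X -> X).
Variables (x e : nat -> X) (eps : nat -> R) (b c : nat -> nat -> R).
Hypotheses (C_bounded : forall y z, C y -> C z -> `|y - z| <= kappa)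
  (x_C : forall n, C (x n)) (T_C : forall y, C y -> C (T y))
  (T_lip : forall y z, C y -> C z -> `|T y - T z| <= ell * `|y - z|)
  (ell_ge0 : 0 <= ell) (ell_le1 : ell <= 1)
  (alpha_ge0 : 0 <= alpha) (alpha_le1 : alpha <= 1)
  (x_iter : forall n, x n.+1 = (1 - alpha) *: x n + alpha *: (T (x n) + e n))
  (eps_ge0 : forall n, 0 <= eps n)
  (e_le : forall n, `|e n| <= kappa * eps n).
Hypotheses (b0 : forall k, b 0 k = 1) (c0 : forall p, c p 0 = 0)
  (bS : forall p k, b p.+1 k = (1 - alpha) * b p k.+1 + alpha * ell * c p k.+1)
  (cS : forall p k, c p k.+1 = (1 - alpha) * c p k + alpha * b p k).

(* An error eps_i with i < p has met both orbits; one with p <= i < p + k only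
   the orbit of x_(p+k), whence the single factor alpha. *)
Let err (d : nat -> nat -> R) p k : R :=
  d p k + \sum_(i < p) 2 * alpha * d (p - 1 - i)%N k * eps i +
  alpha * \sum_(i < k) eps (p + i)%N.

Let normB_le_err_base n : `|x 0 - T (x n)| <= kappa * err b 0 n.
Proof.
have k0 : 0 <= kappa by apply: le_trans (C_bounded (x_C 0) (x_C 0)).
apply: (le_trans (C_bounded (x_C 0) (T_C (x_C n)))).
by rewrite /err big_ord0 addr0 b0 ler_peMr // lerDl mulr_ge0 // sumr_ge0.
Qed.

(** The error of step p now reaches both orbits: alpha comes from x_(p+1), and at most alpha from
    the other orbit. The term i = p on the right has weight 2 alpha b(0,k) = 2 alpha and absorbs
    both. *)
Let errbS p k : (1 - alpha) * err b p k.+1 + alpha * ell * err c p k.+1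
  + alpha * eps p <= err b p.+1 k.
Proof.
rewrite /err bS [\sum_(i < p.+1) _]big_ord_recr /=.
rewrite (_ : p.+1 - 1 - p = 0)%N ?b0 ?mulr1; last by rewrite subn1 subnn.
under [X in _ <= _ + (X + _) + _]eq_bigr do rewrite subn1 /=.
rewrite [\sum_(i < k.+1) _]big_ord_recl /= addn0.
set S := \sum_(i < k) _.
have -> : \sum_(i < k) eps (p.+1 + i)%N = S.
  by apply: eq_bigr => i _; rewrite /= /bump /= add1n addSnnS.
have -> : \sum_(i < p) 2 * alpha * b (p - i)%N k * eps i =
  (1 - alpha) * (\sum_(i < p) 2 * alpha * b (p - 1 - i)%N k.+1 * eps i) +
  alpha * ell * (\sum_(i < p) 2 * alpha * c (p - 1 - i)%N k.+1 * eps i).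
  rewrite !big_distrr /= -big_split /=; apply: eq_bigr => i _.
  have -> : (p - i = (p - 1 - i).+1)%N by rewrite subnAC subn1 prednK ?subn_gt0.
  by rewrite bS; ring.
have S0 : 0 <= S by apply: sumr_ge0.
have e0 := eps_ge0 p.
rewrite -subr_ge0.
set u := (X in 0 <= X).
(* An error met by one orbit only has weight alpha (1 - alpha + alpha ell) on the left and alpha
   available on the right; the difference is alpha^2 (1 - ell) for each of the steps p, ..., p +
   k. *)
have -> : u = alpha * (alpha * (1 - ell)) * (eps p + S).
  by rewrite /u; ring.
have l0 : 0 <= alpha * (1 - ell) by rewrite mulr_ge0 ?subr_ge0.
by rewrite mulr_ge0 ?(addr_ge0 e0) ?(mulr_ge0 _ l0).
Qed.

(** Equality holds because the weights 1 - alpha and alpha sum to 1, so the errors met by one orbit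
    keep weight alpha, and the new error of step p + k joins them with that weight. *)
Let errcS p k : (1 - alpha) * err c p k + alpha * err b p k
  + alpha * eps (p + k)%N = err c p k.+1.
Proof.
rewrite /err cS [\sum_(i < k.+1) eps _]big_ord_recr /=.
have -> : \sum_(i < p) 2 * alpha * c (p - 1 - i)%N k.+1 * eps i =
  (1 - alpha) * (\sum_(i < p) 2 * alpha * c (p - 1 - i)%N k * eps i) +
  alpha * (\sum_(i < p) 2 * alpha * b (p - 1 - i)%N k * eps i).
  rewrite !big_distrr /= -big_split /=; apply: eq_bigr => i _.
  by rewrite cS; ring.
by ring.
Qed.

(** Outer induction on p for residuals at all gaps. At each fixed p, an inner induction on the gap
    turns residual bounds into distance bounds, which the next p requires. *)
Lemma perturbed_iteration_le p k :
  `|x p - T (x (p + k)%N)| <= kappa * err b p k /\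
  `|x p - x (p + k)%N| <= kappa * err c p k.
Proof.
have kappa_ge0 : 0 <= kappa by apply: le_trans (C_bounded (x_C 0) (x_C 0)).
have c_of_b q : (forall j, `|x q - T (x (q + j)%N)| <= kappa * err b q j) ->
    forall j, `|x q - x (q + j)%N| <= kappa * err c q j.
  move=> Hb; elim=> [|j IHj].
    rewrite addn0 subrr normr0 /err c0 big_ord0 mulr0 addr0 add0r.
    by rewrite big1 ?mulr0 // => i _; rewrite c0 mulr0 mul0r.
  rewrite addnS x_iter -errcS.
  apply: le_trans (norm_sub_relax_le _ _ _ _ alpha_ge0 alpha_le1) _.
  have := ler_wpM2l alpha_ge0 (e_le (q + j)%N).
  have := ler_wpM2l alpha_ge0 (Hb j).
  have : 0 <= 1 - alpha by rewrite subr_ge0.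
  move=> /ler_wpM2l /(_ _ _ IHj); lra.
suff Hb : forall j, `|x p - T (x (p + j)%N)| <= kappa * err b p j.
  by split; [exact: Hb | exact: c_of_b].
elim: p => [|p IHp] j; first exact: normB_le_err_base.
(* Index p + 1 with gap j and index p with gap j + 1 share the same farther iterate, so only x_(p+1)
   is expanded. *)
rewrite addSnnS distrC x_iter.
apply: le_trans (norm_sub_relax_le _ _ _ _ alpha_ge0 alpha_le1) _.
apply: le_trans (ler_wpM2l kappa_ge0 (errbS p j)).
rewrite 2!(distrC (T (x (p + j.+1)%N))).
have := ler_wpM2l alpha_ge0 (e_le p).
have := ler_wpM2l (mulr_ge0 alpha_ge0 ell_ge0) (c_of_b _ IHp j.+1).
have := ler_wpM2l alpha_ge0 (T_lip (x_C p) (x_C (p + j.+1)%N)).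
have : 0 <= 1 - alpha by rewrite subr_ge0.
move=> /ler_wpM2l /(_ _ _ (IHp j.+1)); lra.
Qed.

End perturbed_iteration.

(** * The kernel sin t / |1 - s e^(it)|^2 *)

Local Notation integral0pi f := (\int[lebesgue_measure]_(t in `[0, pi]) f t).

Section integral_on_segment.
Context {R : realType}.
Implicit Types (f F : R -> R) (a b : R).

Lemma continuous_integrable_itvcc f a b : continuous f ->
  (@lebesgue_measure R).-integrable `[a, b] (EFin \o f).
Proof.
move=> cf; apply: continuous_compact_integrable; first exact: segment_compact.
exact: continuous_subspaceT.
Qed.

Lemma Rintegral_itvcc_is_derive f F a b : a < b -> continuous f ->
  (forall t : R, is_derive t 1 F (f t)) ->
  \int[lebesgue_measure]_(t in `[a, b]) f t = F b - F a.
Proof.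
move=> ab cf dF.
have cF : continuous F.
  move=> t; apply/differentiable_continuous/derivable1_diffP.
  exact: (@ex_derive _ _ _ _ _ _ _ (dF t)).
rewrite /Rintegral (@continuous_FTC2 _ _ F) //.
- exact: continuous_subspaceT.
- split => [t _||].
  + exact: (@ex_derive _ _ _ _ _ _ _ (dF t)).
  + by apply: cvg_at_right_filter; exact: cF.
  + by apply: cvg_at_left_filter; exact: cF.
- by move=> t _; rewrite derive1E derive_val.
Qed.

Lemma sin_natmul_pi n : sin (n%:R * pi) = 0 :> R.
Proof.
elim: n => [|n IHn]; first by rewrite mul0r sin0.
by rewrite -natr1 mulrDl mul1r sinDpi IHn oppr0.
Qed.

Lemma continuous_cosZ (c : R) : continuous (fun t : R => cos (c * t)).
Proof.
move=> t; apply: (@continuous_comp _ _ _ (fun t => c * t) cos).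
  by apply: cvgM; [exact: cvg_cst | exact: cvg_id].
exact: continuous_cos.
Qed.

Lemma continuous_sinZ (c : R) : continuous (fun t : R => sin (c * t)).
Proof.
move=> t; apply: (@continuous_comp _ _ _ (fun t => c * t) sin).
  by apply: cvgM; [exact: cvg_cst | exact: cvg_id].
exact: continuous_sin.
Qed.

Lemma Rintegral_cos_natmul n :
  integral0pi (fun t : R => cos (n%:R * t)) = pi * (n == 0%N)%:R.
Proof.
case: n => [|n].
  under eq_Rintegral do rewrite mul0r cos0.
  rewrite Rintegral_cst //= lebesgue_measure_itv /= lte_fin pi_gt0 /=.
  by rewrite subr0 mulr1 mul1r.
have dF (t : R) : is_derive t 1 (fun t => n.+1%:R^-1 * sin (n.+1%:R * t))
    (cos (n.+1%:R * t)).
  have dl : is_derive t 1 (fun t : R => n.+1%:R * t) n.+1%:R.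
    by apply: is_derive_eq; rewrite /GRing.scale /= mulr1.
  have := is_derive1_comp (is_derive_sin (n.+1%:R * t)) dl.
  move=> /(@is_deriveZ _ _ _ _ n.+1%:R^-1) /= dF; apply: is_derive_eq dF _.
  by rewrite /GRing.scale /= mulrCA mulVf ?mulr1 ?pnatr_eq0.
rewrite (Rintegral_itvcc_is_derive (pi_gt0 _) (@continuous_cosZ _) dF).
by rewrite /= sin_natmul_pi !mulr0 ?sin0 ?mulr0 subrr.
Qed.

(** Orthogonality of sines by product-to-sum; it supplies the inhomogeneous term of [a_rec]. *)
Lemma Rintegral_sin_sin_natmul n :
  integral0pi (fun t : R => sin t * sin (n.+1%:R * t)) = pi / 2 * (n == 0%N)%:R.
Proof.
have E (t : R) : sin t * sin (n.+1%:R * t) =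
    2^-1 * cos (n%:R * t) - 2^-1 * cos (n.+2%:R * t).
  have -> : n%:R * t = n.+1%:R * t - t by rewrite -natr1; ring.
  have -> : n.+2%:R * t = n.+1%:R * t + t by rewrite -natr1; ring.
  by rewrite cosB cosD; field.
under eq_Rintegral do rewrite E.
have ci k : (@lebesgue_measure R).-integrable `[0, pi]
    (EFin \o (fun t : R => cos (k%:R * t))).
  by apply: continuous_integrable_itvcc; exact: continuous_cosZ.
have cZi k : (@lebesgue_measure R).-integrable `[0, pi]
    (EFin \o (fun t : R => 2^-1 * cos (k%:R * t))).
  apply: continuous_integrable_itvcc => t.
  by apply: cvgM; [exact: cvg_cst | exact: continuous_cosZ].
rewrite RintegralB //.
rewrite !RintegralZl // !Rintegral_cos_natmul.
by case: n {E} => [|n] /=; rewrite ?mulr0 ?mulr1 ?subr0 // mulrC.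
Qed.

End integral_on_segment.

Section kernel_integral.
Context {R : realType}.
Variable s : R.
Hypotheses (s_gt0 : 0 < s) (s_lt1 : s < 1).
Implicit Types f g : R -> R.

(* |1 - s e^(it)|^2 *)
Let den (t : R) := 1 + s ^+ 2 - 2 * s * cos t.

Lemma kernel_den_ge t : (1 - s) ^+ 2 <= den t.
Proof.
rewrite -subr_ge0.
have -> : den t - (1 - s) ^+ 2 = 2 * s * (1 - cos t) by rewrite /den; ring.
by rewrite !mulr_ge0 ?subr_ge0 ?cos_le1 // ltW.
Qed.

Lemma kernel_den_gt0 t : 0 < den t.
Proof. by apply: lt_le_trans (kernel_den_ge t); rewrite exprn_gt0 ?subr_gt0. Qed.

(** On sin((k+1)t) this gives pi / 2 times a Fourier sine coefficient of the kernel. *)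
Definition kernel_integral f := integral0pi (fun t : R => sin t * f t / den t).

Lemma continuous_kernel f : continuous f ->
  continuous (fun t => sin t * f t / den t).
Proof.
move=> cf t; apply: cvgM.
  by apply: cvgM; [exact: continuous_sin | exact: cf].
apply: cvgV; first by rewrite gt_eqF ?kernel_den_gt0.
apply: cvgB; first exact: cvg_cst.
by apply: cvgM; [exact: cvg_cst | exact: continuous_cos].
Qed.

Lemma kernel_integralZ a f : continuous f ->
  kernel_integral (fun t => a * f t) = a * kernel_integral f.
Proof.
move=> cf; rewrite /kernel_integral -RintegralZl //; last first.
  by apply: continuous_integrable_itvcc; exact: continuous_kernel.
by apply: eq_Rintegral => t _; ring.
Qed.

Lemma kernel_integralD f g : continuous f -> continuous g ->
  kernel_integral (fun t => f t + g t) = kernel_integral f + kernel_integral g.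
Proof.
move=> cf cg; rewrite /kernel_integral -RintegralD //; first last.
- by apply: continuous_integrable_itvcc; exact: continuous_kernel.
- by apply: continuous_integrable_itvcc; exact: continuous_kernel.
by apply: eq_Rintegral => t _; ring.
Qed.

Lemma kernel_integral_lin a b f g : continuous f -> continuous g ->
  kernel_integral (fun t => a * f t + b * g t) =
  a * kernel_integral f + b * kernel_integral g.
Proof.
move=> cf cg; rewrite kernel_integralD ?kernel_integralZ //.
- by move=> t; apply: cvgM; [exact: cvg_cst | exact: cf].
- by move=> t; apply: cvgM; [exact: cvg_cst | exact: cg].
Qed.

Let a k := kernel_integral (fun t => sin (k%:R * t)).

(** The bound is uniform in k, as required to exclude solutions growing like s^(-k). *)
Let a_bounded k : `|a k| <= pi / (1 - s) ^+ 2.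
Proof.
have ck := continuous_kernel (@continuous_sinZ R k%:R).
apply: le_trans (le_normr_Rintegral _ _) _ => //.
  exact: continuous_integrable_itvcc.
have -> : pi / (1 - s) ^+ 2 = integral0pi (fun t : R => ((1 - s) ^+ 2)^-1).
  rewrite Rintegral_cst //= lebesgue_measure_itv /= lte_fin pi_gt0 /=.
  by rewrite subr0 mulrC.
apply: le_Rintegral => //.
- apply: continuous_integrable_itvcc => t.
  by apply: cvg_norm; exact: ck.
- by apply: continuous_integrable_itvcc => t; exact: cvg_cst.
move=> t _; rewrite normrM normfV (gtr0_norm (kernel_den_gt0 t)).
rewrite ler_pdivrMr ?kernel_den_gt0 //.
have : `|sin t * sin (k%:R * t)| <= 1.
  by rewrite normrM mulr_ile1 // ler_norml sin_geN1 sin_le1.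
move=> /le_trans; apply.
by rewrite ler_pdivlMl ?mulr1 ?kernel_den_ge // exprn_gt0 ?subr_gt0.
Qed.

(** Multiplying sin((k+1)t) by [den] cancels the denominator of the kernel, while 2 cos t
    sin((k+1)t) = sin(kt) + sin((k+2)t) turns the cosine into index shifts. *)
Let a_rec k : (1 + s ^+ 2) * a k.+1 =
  s * a k + s * a k.+2 + pi / 2 * (k == 0%N)%:R.
Proof.
rewrite -Rintegral_sin_sin_natmul /a -kernel_integral_lin;
  do ?exact: continuous_sinZ.
rewrite -kernel_integralZ; last exact: continuous_sinZ.
rewrite /kernel_integral -RintegralD //; first last.
- apply: continuous_integrable_itvcc => t.
  by apply: cvgM; [exact: continuous_sin | exact: continuous_sinZ].
- apply: continuous_integrable_itvcc; apply: continuous_kernel => t.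
  by apply: cvgD; apply: cvgM; do ?[exact: cvg_cst|exact: continuous_sinZ].
apply: eq_Rintegral => t _.
have -> : k%:R * t = k.+1%:R * t - t by rewrite -natr1; ring.
have -> : k.+2%:R * t = k.+1%:R * t + t by rewrite -natr1; ring.
rewrite sinB sinD.
have := kernel_den_gt0 t; rewrite /den => /lt0r_neq0 d0.
by field.
Qed.

Lemma kernel_integral_sin k :
  kernel_integral (fun t => sin (k.+1%:R * t)) = pi / 2 * s ^+ k.
Proof.
(* [a_rec] has characteristic roots s and 1 / s; boundedness of a kills the
   second one. *)
pose d k := a k.+1 - s * a k.
have dS j : d j.+1 = s * d j.+2.
  by have := a_rec j.+1; rewrite /d mulr0 addr0; lra.
have d1X n : d 1%N = s ^+ n * d n.+1.
  elim: n => [|n IHn]; first by rewrite mul1r.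
  by rewrite IHn dS exprS; ring.
pose K : R := pi / (1 - s) ^+ 2.
have d1 : d 1%N = 0.
  apply/eqP; rewrite -normr_le0.
  have cX : s ^+ n * (K + s * K) @[n --> \oo] --> 0 * (K + s * K).
    apply: cvgM; last exact: cvg_cst.
    by apply: cvg_expr; rewrite gtr0_norm.
  rewrite mul0r in cX.
  apply: (ler_cvg_to (@cvg_cst _ _ _ _ _) cX); apply: nearW => n /=.
  rewrite (d1X n) normrM normrX (gtr0_norm s_gt0).
  apply: ler_wpM2l; first by rewrite exprn_ge0 // ltW.
  apply: le_trans (ler_normB _ _) _; rewrite normrM (gtr0_norm s_gt0).
  by rewrite lerD // ?ler_pM2l // a_bounded.
have d0 j : d j.+1 = 0.
  elim: j => // j IHj; have /esym/eqP := dS j.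
  by rewrite IHj mulf_eq0 (gt_eqF s_gt0) /= => /eqP.
(* For k = 0, inserting a(0) = 0 and a(2) = s a(1) into [a_rec] gives a(1) = pi / 2. *)
elim: k => [|k IHk].
  have := a_rec 0%N; have := d0 0%N; rewrite /d /a eqxx expr0 !mulr1.
  have -> : kernel_integral (fun t => sin (0%:R * t)) = 0.
    rewrite /kernel_integral; under eq_Rintegral do rewrite mul0r sin0 mulr0 mul0r.
    by rewrite Rintegral_cst //= mul0r.
  by rewrite mulr0 add0r => /eqP; rewrite subr_eq0 => /eqP ->; lra.
by have := d0 k; rewrite /d /a IHk exprS; lra.
Qed.

End kernel_integral.

(** * Solution of the recursion *)

Section transport_bounds.
Context {R : realType}.
Variables alpha s : R.
Hypotheses (s_gt0 : 0 < s) (s_lt1 : s < 1).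

(* The imaginary part of e^(ikt) w^q, where w = 1 - alpha + alpha s e^(it). *)
Fixpoint Im_expi_wX (k q : nat) (t : R) : R :=
  if q is q'.+1 then
    (1 - alpha) * Im_expi_wX k q' t + alpha * s * Im_expi_wX k.+1 q' t
  else sin (k%:R * t).

(* |w|^2 *)
Definition sqr_norm_w (t : R) : R :=
  (1 - alpha) ^+ 2 + (alpha * s) ^+ 2 + 2 * (1 - alpha) * (alpha * s) * cos t.

(* |w|^2 e^(i(k+1)t) w^q = e^(i(k+1)t) conj(w) w^(q+1) *)
Lemma sqr_norm_wM k q t : sqr_norm_w t * Im_expi_wX k.+1 q t =
  (1 - alpha) * Im_expi_wX k.+1 q.+1 t + alpha * s * Im_expi_wX k q.+1 t.
Proof.
elim: q k => [|q IHq] k; last first.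
  rewrite [Im_expi_wX k.+1 q.+1 t]/= mulrDr.
  by rewrite (mulrCA _ (1 - alpha)) (mulrCA _ (alpha * s)) !IHq /=; ring.
rewrite /=.
have -> : k%:R * t = k.+1%:R * t - t by rewrite -natr1; ring.
have -> : k.+2%:R * t = k.+1%:R * t + t by rewrite -natr1; ring.
by rewrite sinB sinD /sqr_norm_w; ring.
Qed.

Lemma continuous_Im_expi_wX k q : continuous (Im_expi_wX k q).
Proof.
elim: q k => [|q IHq] k; first exact: continuous_sinZ.
by move=> t; apply: cvgD; apply: cvgM; do ?[exact: cvg_cst|exact: IHq].
Qed.

Lemma continuous_sqr_norm_wX p : continuous (fun t => sqr_norm_w t ^+ p).
Proof.
move=> t; apply: (@continuous_comp _ _ _ sqr_norm_w (fun y => y ^+ p));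
  last exact: exprn_continuous.
apply: cvgD; first exact: cvg_cst.
by apply: cvgM; [exact: cvg_cst | exact: continuous_cos].
Qed.

(** The function integrated against the kernel is the imaginary part of e^(ikt) conj(w)^p w^(p+q), a
    product solution with gap q and an extra phase. *)
Let moment p k q :=
  kernel_integral s (fun t => sqr_norm_w t ^+ p * Im_expi_wX k q t).

Let continuous_moment p k q :
  continuous (fun t => sqr_norm_w t ^+ p * Im_expi_wX k q t).
Proof.
move=> t; apply: cvgM;
  [exact: continuous_sqr_norm_wX | exact: continuous_Im_expi_wX].
Qed.

Let momentS p k q :
  moment p k q.+1 = (1 - alpha) * moment p k q + alpha * s * moment p k.+1 q.
Proof.
rewrite /moment -kernel_integral_lin //.
by apply: eq_Rintegral => t _ /=; congr (_ * _ / _); ring.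
Qed.

(** Going from (p, q+1) to (p+1, q) multiplies by conj(w) = 1 - alpha + alpha s e^(-it), whose
    exponential lowers k by one. *)
Let moment_sqr p k q : moment p.+1 k.+1 q =
  (1 - alpha) * moment p k.+1 q.+1 + alpha * s * moment p k q.+1.
Proof.
rewrite /moment -kernel_integral_lin //.
apply: eq_Rintegral => t _; congr (_ * _ / _).
by rewrite exprSr -mulrA sqr_norm_wM; ring.
Qed.

(** Up to a constant, the kernel integral replaces e^(it) by s in powers of positive degree, so w
    becomes 1 - alpha + alpha s^2. *)
Let moment0 k q :
  moment 0 k.+1 q = pi / 2 * s ^+ k * (1 - alpha + alpha * s ^+ 2) ^+ q.
Proof.
elim: q k => [|q IHq] k; last by rewrite momentS !IHq !exprS; ring.
rewrite expr0 mulr1 -kernel_integral_sin //.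
by apply: eq_Rintegral => t _; rewrite expr0 mul1r.
Qed.

Let la := 1 - alpha + alpha * s ^+ 2.

(** For c = u^p v^(p+k) the recursion forces b = ((v - (1 - alpha)) / alpha) c. This ratio is 1 for
    (u, v) = (la, 1), s^2 for (1, la), and s e^(it) for (conj w, w), whence the phase index 1 and
    the extra s here compared with [distance_coef]. The factor 2 / pi makes the moment cancel s^2
    la^k at p = 0. *)
Definition residual_coef p k : R := la ^+ p - s ^+ 2 * la ^+ (p + k) +
  2 * s ^+ 2 / pi * moment p 1 k.

Definition distance_coef p k : R := la ^+ p - la ^+ (p + k) +
  2 * s / pi * moment p 0 k.

Lemma residual_coef0 k : residual_coef 0 k = 1.
Proof.
rewrite /residual_coef moment0 add0n !expr0 -/la.
by move: (pi : R) (lt0r_neq0 (pi_gt0 R)) (la ^+ k) => p p0 l; field.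
Qed.

Lemma distance_coef0 p : distance_coef p 0 = 0.
Proof.
rewrite /distance_coef addn0 subrr add0r /moment.
rewrite /kernel_integral.
under eq_Rintegral do rewrite /= mul0r sin0 mulr0 mulr0 mul0r.
by rewrite Rintegral_cst //= mul0r mulr0.
Qed.

Lemma residual_coefS p k : residual_coef p.+1 k =
  (1 - alpha) * residual_coef p k.+1 + alpha * s ^+ 2 * distance_coef p k.+1.
Proof.
rewrite /residual_coef /distance_coef moment_sqr addSnnS !exprS /la.
by ring.
Qed.

Lemma distance_coefS p k : distance_coef p k.+1 =
  (1 - alpha) * distance_coef p k + alpha * residual_coef p k.
Proof.
rewrite /residual_coef /distance_coef momentS addnS !exprS /la.
by ring.
Qed.

Lemma residual_coef_diag m : residual_coef m 0 = (1 - s ^+ 2) * la ^+ m +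
  2 * s ^+ 2 / pi * integral0pi (fun t =>
    sin t ^+ 2 * sqr_norm_w t ^+ m / (1 + s ^+ 2 - 2 * s * cos t)).
Proof.
rewrite /residual_coef addn0 /moment /kernel_integral.
under eq_Rintegral do rewrite /= mul1r [_ ^+ _ * sin _]mulrC mulrA -expr2.
by ring.
Qed.

End transport_bounds.

(** * Euler's integral *)

Section Gamma_values.
Context {R : realType}.

(** Differentiability is asked only for t > 0, with a right limit at 0, to allow antiderivatives
    containing a square root. *)
Lemma Rintegral_itv_opinfty_is_derive (f F : R -> R) (l : R) :
  continuous f -> (forall t, 0 <= t -> 0 <= f t) ->
  (forall t : R, 0 < t -> is_derive t 1 F (f t)) ->
  F t @[t --> 0^'+] --> F 0 -> F t @[t --> +oo] --> l ->
  \int[lebesgue_measure]_(t in `]0, +oo[) f t = l - F 0.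
Proof.
move=> cf f_ge0 dF F0 Fl; rewrite /Rintegral integral_itv_obnd_cbnd; last first.
  apply/measurable_EFinP; apply: measurable_funS (measurableT) _ _ => //.
  exact: continuous_measurable_fun.
rewrite (@ge0_continuous_FTC2y _ f F _ l) //.
- exact: continuous_subspaceT.
- by move=> t t0; exact: (@ex_derive _ _ _ _ _ _ _ (dF t t0)).
- move=> t; rewrite in_itv /= andbT => t0.
  by rewrite derive1E (@derive_val _ _ _ _ _ _ _ (dF t t0)).
Qed.

(** One term of the exponential series, t^(n+1) / (n+1)! <= e^t, bounds the function by (n+1)! /
    t. *)
Lemma cvg_expr_expRN n : t ^+ n * expR (- t) @[t --> +oo] --> (0 : R).
Proof.
apply: (@squeeze_cvgr _ _ _ _ (fun=> 0) (fun t : R => (n.+1)`!%:R * t^-1)).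
- near=> t.
  have t0 : 0 < t by near: t; exact: nbhs_pinfty_gt.
  rewrite mulr_ge0 ?exprn_ge0 ?expR_ge0 ?(ltW t0) //=.
  rewrite expRN ler_pdivrMr ?expR_gt0 //.
  have := expR_ge1Dxn n (ltW t0).
  set N : R := _`!%:R => H.
  have N0 : 0 < N by rewrite ltr0n fact_gt0.
  have : t ^+ n.+1 / N <= expR t by apply: le_trans H; rewrite lerDr.
  rewrite ler_pdivrMr // exprS => H2.
  by rewrite mulrAC ler_pdivlMr // mulrC (mulrC N).
- exact: cvg_cst.
- rewrite -[X in _ --> X](mulr0 (n.+1)`!%:R).
  apply: cvgM; first exact: cvg_cst.
  by apply/(gtr0_cvgV0 (f := id)); [exact: nbhs_pinfty_gt | exact: cvg_id].
Unshelve. all: by end_near. Qed.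

Lemma Gamma3 : Gamma 3 = 2 :> R.
Proof.
pose f (t : R) := t ^+ 2 * expR (- t).
pose F (t : R) := - ((t ^+ 2 + 2 * t + 2) * expR (- t)).
have dF (t : R) : is_derive t 1 F (f t).
  by apply: is_derive_eq; rewrite /f /GRing.scale /=; ring.
have cF : continuous F.
  move=> t; apply/differentiable_continuous/derivable1_diffP.
  exact: (@ex_derive _ _ _ _ _ _ _ (dF t)).
have cf : continuous f.
  move=> t; apply: cvgM; first exact: exprn_continuous.
  apply: (@continuous_comp _ _ _ -%R expR); first exact: continuousN.
  exact: continuous_expR.
transitivity (\int[lebesgue_measure]_(t in `]0, +oo[) f t).
  apply: eq_Rintegral => t; rewrite inE /= in_itv /= andbT => t0.
  rewrite (_ : 3 - 1 = 2%:R); last by ring.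
  by rewrite powR_mulrn // ltW.
rewrite (@Rintegral_itv_opinfty_is_derive _ F 0) //.
- by rewrite /F oppr0 expR0; ring.
- by move=> t t0; rewrite mulr_ge0 ?exprn_ge0 ?expR_ge0.
- by apply: cvg_at_right_filter; exact: cF.
- rewrite -oppr0; apply: cvgN.
  have -> : 0 = 0 + 2 * 0 + 2 * 0 :> R by ring.
  have := @cvg_expr_expRN.
  rewrite (_ : (fun t : R => _) = fun t => t ^+ 2 * expR (- t) +
     2 * (t ^+ 1 * expR (- t)) + 2 * (t ^+ 0 * expR (- t))); last first.
    by apply/funext => t; ring.
  by move=> H; apply: cvgD; [apply: cvgD => // | ];
     do ?[apply: cvgM; [exact: cvg_cst|]]; exact: H.
Qed.

Lemma cvg_sqrt_pinfty : @Num.sqrt R t @[t --> +oo] --> +oo.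
Proof.
apply/cvgryPge => A; near=> t.
have tA : A ^+ 2 <= t by near: t; apply: nbhs_pinfty_ge; exact: num_real.
apply: le_trans (ler_norm A) _.
by rewrite -sqrtr_sqr ler_sqrt // (le_trans (sqr_ge0 A)).
Unshelve. all: by end_near. Qed.

(** Gamma(3/2) equals the integral of e^(-y^2) over the half-line. Its square is the form used,
    since a = c - a when a = 3/2 and c = 3. *)
Lemma Gamma_3half_sqr : Gamma (3 / 2) ^+ 2 = pi / 4 :> R.
Proof.
pose I := @gauss_integral_proof.integral0_gauss R.
pose f (t : R) := Num.sqrt t * expR (- t).
(* Integration by parts and t = y^2 combined into one antiderivative of f. *)
pose F (t : R) := I (Num.sqrt t) - f t.
have I0 : I 0 = 0.
  by rewrite /I /gauss_integral_proof.integral0_gauss set_itv1 Rintegral_set1.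
have If (u : R) : (@lebesgue_measure R).-integrable `[0, u] (EFin \o gauss_fun).
  by apply: continuous_integrable_itvcc; exact: continuous_gauss_fun.
have dI (y : R) : 0 < y -> is_derive y 1 I (expR (- y ^+ 2)).
  move=> y0.
  have yy1 : y < y + 1 by rewrite ltrDl.
  have [d1 d2] := continuous_FTC1_closed yy1 (If _) y0
    (@continuous_gauss_fun R y).
  by split; [exact: d1 | rewrite -derive1E; exact: d2].
have dF (t : R) : 0 < t -> is_derive t 1 F (f t).
  move=> t0.
  have st0 : 0 < Num.sqrt t by rewrite sqrtr_gt0.
  have dIt := dI _ st0.
  have ds := is_derive1_sqrt t0.
  have dIs := is_derive1_comp dIt ds.
  have dN : is_derive t 1 (fun t : R => expR (- t)) (- expR (- t)).
    by apply: is_derive_eq; rewrite /GRing.scale /=; ring.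
  have dP : is_derive t 1 f
      (Num.sqrt t * - expR (- t) + expR (- t) * (2 * Num.sqrt t)^-1).
    by have := is_deriveM ds dN.
  apply: (is_derive_eq (is_deriveB dIs dP)).
  rewrite sqr_sqrtr ?(ltW t0) // /f; ring.
have cf : continuous f.
  move=> t; apply: cvgM; first exact: sqrt_continuous.
  apply: (@continuous_comp _ _ _ -%R expR); first exact: continuousN.
  exact: continuous_expR.
have -> : Gamma (3 / 2) = \int[lebesgue_measure]_(t in `]0, +oo[) f t.
  apply: eq_Rintegral => t; rewrite inE /= in_itv /= andbT => t0.
  rewrite (_ : 3 / 2 - 1 = 2^-1); last by field.
  by rewrite powR12_sqrt // ltW.
have Iy : I t @[t --> +oo] --> Num.sqrt (pi / 4).
  (* The known limit concerns I^2; nonnegativity of I lets the square root carry it over. *)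
  have -> : I = Num.sqrt \o (fun t => I t ^+ 2).
    apply/funext => t /=; rewrite sqrtr_sqr ger0_norm //.
    exact: gauss_integral_proof.integral0_gauss_ge0.
  apply: (@cvg_comp _ _ _ (fun t => I t ^+ 2) Num.sqrt _ (nbhs (pi / 4 : R))).
    exact: gauss_integral_proof.cvg_integral0_gauss_sqr.
  exact: sqrt_continuous.
rewrite (@Rintegral_itv_opinfty_is_derive _ F (Num.sqrt (pi / 4))) //.
- rewrite /F /f sqrtr0 I0 mul0r !subr0 sqr_sqrtr //.
  by rewrite divr_ge0 ?pi_ge0.
- by move=> t t0; rewrite mulr_ge0 ?sqrtr_ge0 ?expR_ge0.
- apply: cvg_at_right_filter; apply: cvgB; last exact: cf.
  rewrite sqrtr0 I0.
  apply: (@cvg_comp _ _ _ Num.sqrt I _ (nbhs (0 : R))).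
    by have := @sqrt_continuous R 0; rewrite /continuous_at sqrtr0.
  exact: parameterized_integral_cvg_left ltr01 (If _).
- rewrite -[X in _ --> X]subr0; apply: cvgB.
    exact: cvg_comp cvg_sqrt_pinfty Iy.
  apply: (@squeeze_cvgr _ _ _ _ (fun=> 0) (fun t : R => t ^+ 1 * expR (- t))).
  + near=> t.
    have t1 : 1 <= t by near: t; apply: nbhs_pinfty_ge; exact: num_real.
    have t0 : 0 <= t by apply: le_trans t1.
    rewrite /f mulr_ge0 ?sqrtr_ge0 ?expR_ge0 //= ler_wpM2r ?expR_ge0 //.
    by rewrite -[leRHS](ger0_norm t0) -sqrtr_sqr ler_sqrt ?expr2 ?ler_peMr ?mulr_ge0.
  + exact: cvg_cst.
  + exact: cvg_expr_expRN.
Unshelve. all: by end_near. Qed.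

End Gamma_values.

Section Euler_integral.
Context {R : realType}.

(** For these parameters the weight is sqrt(x (1 - x)). With x = (1 - cos t) / 2, both this weight
    and dx/dt equal sin t / 2, which produces sin^2 t / 4; the Gamma factors contribute 2 / (pi / 4)
    = 8 / pi. *)
Lemma appellF1_3half_trig (m : nat) (u v : R) : u <= 1 -> v < 1 ->
  appellF1 (3 / 2) (- m%:R) 1 3 u v = 2 / pi * integral0pi (fun t : R =>
    sin t ^+ 2 * (1 - u * ((1 - cos t) / 2)) ^+ m /
      (1 - v * ((1 - cos t) / 2))).
Proof.
move=> u1 v1; rewrite /appellF1.
pose F (t : R) := (1 - cos t) / 2.
pose G (x : R) := Num.sqrt x * Num.sqrt (1 - x) * (1 - u * x) ^+ m / (1 - v * x).
have den_gt0 (x : R) : 0 <= x -> x <= 1 -> 0 < 1 - v * x.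
    by move=> x0 x1; have [v0|v0] := lerP v 0; nra.
have cG : {within `[0, 1], continuous G}.
  apply: continuous_in_subspaceT => x; rewrite inE /= in_itv /= => /andP[x0 x1].
  have cB a : 1 - a * y @[y --> x] --> 1 - a * x.
    by apply: cvgB; [exact: cvg_cst | apply: cvgM; [exact: cvg_cst|exact: cvg_id]].
  apply: cvgM; last by apply: cvgV; [rewrite gt_eqF ?den_gt0 | exact: cB].
  apply: cvgM.
    apply: cvgM; first exact: sqrt_continuous.
    apply: (@cvg_comp _ _ _ (fun y => 1 - y) Num.sqrt _ (nbhs (1 - x))).
      by apply: cvgB; [exact: cvg_cst | exact: cvg_id].
    exact: sqrt_continuous.
  apply: (@cvg_comp _ _ _ (fun y => 1 - u * y) (fun y => y ^+ m) _
    (nbhs (1 - u * x))); [exact: cB | exact: exprn_continuous].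
have iG : (@lebesgue_measure R).-integrable `[0, 1] (EFin \o G).
  by apply: continuous_compact_integrable => //; exact: segment_compact.
have dF (t : R) : is_derive t 1 F (sin t / 2).
  by apply: is_derive_eq; rewrite /GRing.scale /=; field.
have F'E : F^`()%classic = fun t => sin t / 2.
  by apply/funext => t; rewrite derive1E (@derive_val _ _ _ _ _ _ _ (dF t)).
have cF' : continuous F^`()%classic.
  by rewrite F'E => t; apply: cvgM; [exact: continuous_sin | exact: cvg_cst].
have cF : continuous F.
  move=> t; apply/differentiable_continuous/derivable1_diffP.
  exact: (@ex_derive _ _ _ _ _ _ _ (dF t)).
have F0 : F 0 = 0 by rewrite /F cos0 subrr mul0r.
have Fpi : F pi = 1 by rewrite /F cospi; field.
have -> : \int[lebesgue_measure]_(x in `]0, 1[)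
    (x `^ (3 / 2 - 1) * (1 - x) `^ (3 - 3 / 2 - 1) /
     ((1 - u * x) `^ (- m%:R) * (1 - v * x) `^ 1)) =
    \int[lebesgue_measure]_(x in `[0, 1]) G x.
  rewrite -Rintegral_itv_obnd_cbnd; last first.
    by apply: integrableS iG => //; apply: subset_itvr; rewrite bnd_simp.
  rewrite -Rintegral_itv_bndo_bndc; last first.
    by apply: integrableS iG => //; apply: subset_itv; rewrite bnd_simp.
  apply: eq_Rintegral => x; rewrite inE /= in_itv /= => /andP[x0 x1].
  rewrite (_ : 3 / 2 - 1 = 2^-1); last by field.
  rewrite (_ : 3 - 3 / 2 - 1 = 2^-1); last by field.
  (* This is where u <= 1 enters: [powR] with exponent m is the ordinary power on nonnegative
     bases. *)
  have ux : 0 <= 1 - u * x by nra.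
  rewrite !powR12_sqrt ?(ltW x0) ?subr_ge0 ?(ltW x1) // powRN powR_mulrn //.
  by rewrite powRr1 ?(ltW (den_gt0 _ _ _)) ?(ltW x0) ?(ltW x1) // invfM invrK mulrA.
have -> : \int[lebesgue_measure]_(x in `[0, 1]) G x =
    4^-1 * integral0pi (fun t : R => sin t ^+ 2 * (1 - u * F t) ^+ m / (1 - v * F t)).
  have F01 (t : R) : 0 <= F t /\ F t <= 1.
    have := cos_le1 t; have := cos_geN1 t.
    by rewrite /F => ? ?; split; lra.
  rewrite -RintegralZl //; last first.
    apply: continuous_integrable_itvcc => t.
    have cB a : 1 - a * F y @[y --> t] --> 1 - a * F t.
      by apply: cvgB; [exact: cvg_cst | apply: cvgM; [exact: cvg_cst|exact: cF]].
    have [Ft0 Ft1] := F01 t.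
    apply: cvgM; last by apply: cvgV; [rewrite gt_eqF ?den_gt0 | exact: cB].
    apply: cvgM.
      apply: (@cvg_comp _ _ _ sin (fun y => y ^+ 2) _ (nbhs (sin t)));
        [exact: continuous_sin | exact: exprn_continuous].
    apply: (@cvg_comp _ _ _ (fun y => 1 - u * F y) (fun y => y ^+ m) _
      (nbhs (1 - u * F t))); [exact: cB | exact: exprn_continuous].
  have := @integration_by_substitution_increasing R F G 0 pi (pi_ge0 _).
  rewrite F0 Fpi /Rintegral => ->//.
  - congr fine; apply: eq_integral => t.
    rewrite inE /= in_itv /= => /sin_ge0_pi st; congr EFin.
    rewrite F'E; transitivity (G (F t) * (sin t / 2)); first by [].
    have [Ft0 Ft1] := F01 t.
    (* Since 4 x (1 - x) = 1 - cos^2 t, the root is |sin t| / 2, and sin t >= 0 on this interval. *)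
    rewrite /G -sqrtrM // (_ : F t * (1 - F t) = (sin t / 2) ^+ 2); last first.
      by rewrite expr_div_n sin2cos2 /F; field.
    rewrite sqrtr_sqr ger0_norm ?divr_ge0 //.
    by field; rewrite gt_eqF ?den_gt0.
  - by move=> x y x0p y0p xy; rewrite /F ltr_pM2r // ltrD2l ltrN2 ltr_cos.
  - by apply/cvg_ex; exists (F^`()%classic 0); apply: cvg_at_right_filter; exact: cF'.
  - by apply/cvg_ex; exists (F^`()%classic pi); apply: cvg_at_left_filter; exact: cF'.
  - split=> [t _||].
    + exact: (@ex_derive _ _ _ _ _ _ _ (dF t)).
    + by apply: cvg_at_right_filter; exact: cF.
    + by apply: cvg_at_left_filter; exact: cF.
have -> : 3 - 3 / 2 = 3 / 2 :> R by field.
rewrite Gamma3 -expr2 Gamma_3half_sqr mulrA; congr (_ * _).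
by move: (pi : R) (lt0r_neq0 (pi_gt0 R)) => p p0; field.
Qed.

End Euler_integral.

(** * Identification with the closed form, and the residual bound *)

(** The parameters [eta] and [xi] are such that, at x = (1 - cos t) / 2, 1 - eta x and 1 + xi x are
    |w|^2 and |1 - s e^(it)|^2 divided by their values s_alpha and (1 - s)^2 at t = 0. The
    prefactors of R_m cancel these normalizations. *)
Lemma residual_boundE (R : realType) (alpha ell : R) (m : nat) :
    0 < ell -> ell < 1 -> 0 < alpha -> alpha <= 1 ->
  residual_bound alpha ell m = residual_coef alpha (sigma ell) m 0.
Proof.
move=> ell_gt0 ell_lt1 alpha_gt0 alpha_le1.
have s_gt0 : 0 < sigma ell by rewrite sqrtr_gt0.
have s_lt1 : sigma ell < 1 by rewrite -sqrtr1 ltr_sqrt.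
have sE : sigma ell ^+ 2 = ell by rewrite sqr_sqrtr // ltW.
rewrite residual_coef_diag sE /residual_bound /ell_alpha; congr (_ + _).
move: sE s_gt0 s_lt1; set s := sigma ell => sE s_gt0 s_lt1.
have w_gt0 : 0 < 1 - alpha + alpha * s by nra.
have sa_gt0 : 0 < s_alpha alpha ell by rewrite exprn_gt0.
have s1_gt0 : 0 < (1 - s) ^+ 2 by rewrite exprn_gt0 ?subr_gt0.
(* Equality occurs when 1 - alpha = alpha s, so Euler's integral must be available at u = 1. *)
have eta_le1 : Defs.eta alpha ell <= 1.
  rewrite /Defs.eta ler_pdivrMr // mul1r -subr_ge0 /s_alpha -/s.
  by rewrite (_ : _ - _ = (1 - alpha - alpha * s) ^+ 2) ?sqr_ge0 //; ring.
have xi_gt0 : 0 < xi ell by rewrite /xi -/s divr_gt0 // mulr_gt0.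
rewrite appellF1_3half_trig //; last lra.
have -> : integral0pi (fun t : R => sin t ^+ 2 *
      (1 - Defs.eta alpha ell * ((1 - cos t) / 2)) ^+ m /
      (1 - - xi ell * ((1 - cos t) / 2))) =
    (1 - s) ^+ 2 / s_alpha alpha ell ^+ m * integral0pi (fun t : R =>
      sin t ^+ 2 * sqr_norm_w alpha s t ^+ m /
      (1 + ell - 2 * s * cos t)).
  rewrite -RintegralZl //; last first.
    rewrite (_ : (fun t => _ / _) = fun t => sin t *
        (sin t * sqr_norm_w alpha s t ^+ m) / (1 + s ^+ 2 - 2 * s * cos t)).
      apply: continuous_integrable_itvcc; apply: continuous_kernel => // t.
      by apply: cvgM; [exact: continuous_sin | exact: continuous_sqr_norm_wX].
    by apply/funext => t; rewrite sE expr2 mulrA.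
  apply: eq_Rintegral => t _.
  have := kernel_den_gt0 s_gt0 s_lt1 t; rewrite sE => den_gt0.
  have -> : 1 - Defs.eta alpha ell * ((1 - cos t) / 2) =
      sqr_norm_w alpha s t / s_alpha alpha ell.
    apply: (@mulIf _ (s_alpha alpha ell)); first by rewrite gt_eqF.
    rewrite divfK ?gt_eqF // mulrBl mul1r mulrAC /Defs.eta divfK ?gt_eqF //.
    rewrite /s_alpha /sqr_norm_w -/s.
    by move: (cos t) (s) => y r; field.
  have -> : 1 - - xi ell * ((1 - cos t) / 2) =
      (1 + ell - 2 * s * cos t) / (1 - s) ^+ 2.
    apply: (@mulIf _ ((1 - s) ^+ 2)); first by rewrite gt_eqF.
    rewrite divfK ?gt_eqF // mulrBl mul1r mulrAC mulNr /xi divfK ?gt_eqF //.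
    rewrite -/s -sE.
    by move: (cos t) (s) => y r; field.
  rewrite expr_div_n.
  have := lt0r_neq0 (exprn_gt0 m sa_gt0).
  have := lt0r_neq0 s1_gt0; have := lt0r_neq0 den_gt0.
  move: (_ - _ * cos t) ((1 - s) ^+ 2) (s_alpha alpha ell ^+ m) (sin t).
  move: (sqr_norm_w alpha s t ^+ m) => N d q a y d0 q0 a0.
  by field; rewrite d0 q0 a0.
move: (Rintegral _ _ _) => J.
have := lt0r_neq0 (pi_gt0 R); have := lt0r_neq0 (exprn_gt0 m sa_gt0).
have := lt0r_neq0 s1_gt0.
move: (pi : R) ((1 - s) ^+ 2) (s_alpha alpha ell ^+ m) => p q a q0 a0 p0.
by field; rewrite p0 q0 a0.
Qed.

Theorem theorem14 (R : realType) (X : normedModType R) (C : set X)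
    (kappa ell alpha : R) (T : X -> X) (x e : nat -> X) (eps : nat -> R)
    (C_convex : convex_set (C : set (convex_lmodType X)))
    (C_diam : (diam C <= kappa%:E)%E)
    (T_self : set_fun C C T)
    (T_lip : ell.-lipschitz_C T)
    (ell_gt0 : 0 < ell) (ell_lt1 : ell < 1)
    (alpha_gt0 : 0 < alpha) (alpha_le1 : alpha <= 1)
    (x0_C : C (x 0%N))
    (x_iter : forall m : nat,
      x m.+1 = (1 - alpha) *: x m + alpha *: (T (x m) + e m))
    (Te_C : forall m : nat, C (T (x m) + e m))
    (eps_ge0 : forall m : nat, 0 <= eps m)
    (e_le : forall m : nat, `|e m| <= kappa * eps m) :
  forall m : nat,
    `|x m - T (x m)| <=
    kappa * (residual_bound alpha ell m +
             2 * alpha *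
               \sum_(i < m) residual_bound alpha ell (m - 1 - i)%N * eps i +
             2 * eps m).
Proof.
move=> m.
have C_bounded y z : C y -> C z -> `|y - z| <= kappa.
  move=> Cy Cz; rewrite -lee_fin; apply: le_trans C_diam.
  by apply: ereal_sup_ubound; exists (y, z).
have kappa_ge0 : 0 <= kappa by apply: le_trans (C_bounded _ _ x0_C x0_C).
(* By convexity of [C], alpha being the weight of T x_n + e_n. *)
have x_C n : C (x n).
  elim: n => [//|n IHn]; rewrite x_iter addrC.
  have := C_convex _ _ (Itv01 (ltW alpha_gt0) alpha_le1)
    (mem_set (Te_C n)) (mem_set IHn).
  by rewrite inE.
have T_lipC y z : C y -> C z -> `|T y - T z| <= ell * `|y - z|.
  by move=> Cy Cz; exact: (T_lip (y, z)).
have s_gt0 : 0 < sigma ell by rewrite sqrtr_gt0.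
have s_lt1 : sigma ell < 1 by rewrite -sqrtr1 ltr_sqrt.
have sE : sigma ell ^+ 2 = ell by rewrite sqr_sqrtr // ltW.
have [+ _] := @perturbed_iteration_le R X C kappa ell alpha T x e eps
  (residual_coef alpha (sigma ell)) (distance_coef alpha (sigma ell))
  C_bounded x_C T_self T_lipC (ltW ell_gt0) (ltW ell_lt1) (ltW alpha_gt0)
  alpha_le1 x_iter eps_ge0 e_le (residual_coef0 _ s_gt0 s_lt1)
  (distance_coef0 _ _)
  (fun p k => etrans (residual_coefS _ s_gt0 s_lt1 p k)
    (congr1 (fun l => _ + alpha * l * _) sE))
  (distance_coefS _ s_gt0 s_lt1) m 0.
rewrite addn0 => /le_trans; apply; apply: ler_wpM2l => //.
(* At gap 0 no error has been met by one orbit only, so that sum is empty. *)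
rewrite big_ord0 mulr0 addr0 residual_boundE //.
have -> : 2 * alpha * \sum_(i < m) residual_bound alpha ell (m - 1 - i)%N * eps i
  = \sum_(i < m) 2 * alpha * residual_coef alpha (sigma ell) (m - 1 - i)%N 0 * eps i.
  by rewrite big_distrr; apply: eq_bigr => i _ /=; rewrite residual_boundE // mulrA.
by rewrite lerDl mulr_ge0.
Qed.
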